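(* For every square invertible submatrix $B$ of a sign pattern $S$ there is a balanced square submatrix $A$ of $S$ with $m(A)=m(B)$. In fact, $A$ can be chosen to be a submatrix of $B$.
   Context: A sign pattern is a (not necessarily square) matrix each of whose entries is $0$ or $\pm$ a free variable, with a separate free variable for each position. A square sign pattern is invertible if its determinant, as a polynomial in the free variables, is nonzero. For a square sign pattern $A$, $m_\pm(A)$ is the number of terms of sign $\pm$ in $\det A$ viewed as a polynomial in the free variables, and $m(A)=\min\{m_-(A),m_+(A)\}$. The bipartite graph $G(S)$ has a vertex for each row and each column of $S$ and an edge joining row $r$ and column $c$ iff the $(r,c)$ entry of $S$ is nonzero. A cycle is a closed simple path, with no repeated vertices other than the starting and ending vertices. A set of cycles in $G(S)$ is called balanced if the number of rows they touch is the same as the number of columns they touch. Every balanced set of cycles picks out a square submatrix $A$ of $S$ (formed by the rows and columns touched); such a submatrix is called balanced. Each column and row of a balanced $A$ appears in at least one cycle in $G(A)$. *)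

(* Defs.v *)
From mathcomp Require Import all_boot all_order all_algebra.
From mathcomp Require Import mpoly.

Set Implicit Arguments.
Unset Strict Implicit.
Unset Printing Implicit Defensive.

Import Order.TTheory GRing.Theory Num.Theory.
Local Open Scope ring_scope.

(* The free variable attached to position [(i, j)] of an [m x n] matrix is
   ['X_(mxvec_index i j)]; [mxvec_index] is a bijection from positions onto
   ['I_(m * n)], so distinct positions carry distinct variables. *)
Definition sign_pattern (m n : nat) (S : 'M[{mpoly int[m * n]}]_(m, n)) : Prop :=
  forall (i : 'I_m) (j : 'I_n),
    [\/ S i j = 0, S i j = 'X_(mxvec_index i j)
      | S i j = - 'X_(mxvec_index i j)].

(* A submatrix is [mxsub f g S] with [f] and [g] increasing: the rows in the
   range of [f] and the columns in the range of [g], in their original order. *)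
Definition increasing (k m : nat) (f : 'I_k -> 'I_m) : Prop :=
  forall i j : 'I_k, (i < j)%N -> (f i < f j)%N.

Definition invertible_pattern (N k : nat) (A : 'M[{mpoly int[N]}]_k) : Prop :=
  \det A != 0.

Definition m_plus (N k : nat) (A : 'M[{mpoly int[N]}]_k) : nat :=
  count (fun u : 'X_{1..N} => 0 < (\det A)@_u) (msupp (\det A)).

Definition m_minus (N k : nat) (A : 'M[{mpoly int[N]}]_k) : nat :=
  count (fun u : 'X_{1..N} => (\det A)@_u < 0) (msupp (\det A)).

Definition m_min (N k : nat) (A : 'M[{mpoly int[N]}]_k) : nat :=
  minn (m_minus A) (m_plus A).

(* Vertices of the bipartite graph: [inl r] is row [r], [inr c] is column [c]. *)
Definition vertex (m n : nat) : finType := ('I_m + 'I_n)%type.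

Definition bigraph (N m n : nat) (S : 'M[{mpoly int[N]}]_(m, n)) :
    rel (vertex m n) :=
  fun u v => match u, v with
             | inl r, inr c | inr c, inl r => S r c != 0
             | _, _ => false
             end.

(* A cycle is given by its list of vertices without the repeated endpoint.
   The size bound excludes an edge traversed back and forth, which [ucycleb]
   accepts. *)
Definition is_cycle (N m n : nat) (S : 'M[{mpoly int[N]}]_(m, n))
    (p : seq (vertex m n)) : bool :=
  ucycleb (bigraph S) p && (2 < size p)%N.

(* Sets of cycles are represented by lists; only the vertices they touch
   matter, so order and repetition are irrelevant. *)
Definition rows_touched (m n : nat) (cs : seq (seq (vertex m n))) : {set 'I_m} :=
  [set r : 'I_m | has (fun p => (inl r : vertex m n) \in p) cs].

Definition cols_touched (m n : nat) (cs : seq (seq (vertex m n))) : {set 'I_n} :=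
  [set c : 'I_n | has (fun p => (inr c : vertex m n) \in p) cs].

Definition balanced_cycles (N m n : nat) (S : 'M[{mpoly int[N]}]_(m, n))
    (cs : seq (seq (vertex m n))) : Prop :=
  all (is_cycle S) cs /\ #|rows_touched cs| = #|cols_touched cs|.

(* [mxsub f g S] is balanced as a submatrix of [S].  The empty set of cycles is
   balanced and picks out the 0 x 0 submatrix, whose determinant is 1. *)
Definition balanced_submatrix (N m n k : nat) (S : 'M[{mpoly int[N]}]_(m, n))
    (f : 'I_k -> 'I_m) (g : 'I_k -> 'I_n) : Prop :=
  exists cs : seq (seq (vertex m n)),
    [/\ balanced_cycles S cs,
        rows_touched cs = [set f i | i : 'I_k]
      & cols_touched cs = [set g i | i : 'I_k]].

(* Main.v *)
(* Fix a permutation [s] with a nonzero term in [\det B], i.e. a perfect matching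
   of [G(B)]. If every row [i] is matched differently by some other perfect
   matching [t], the component of [i] in the symmetric difference of [s] and [t]
   is a cycle through row [i] and column [s i], so such cycles touch all of [B]
   and [B] is balanced. Otherwise some entry [(i, s i)] lies in every perfect
   matching, so [\det B] is plus or minus a variable times the complementary
   minor, which has the same [m_min], and one concludes by induction on size. *)
Require Import Defs.
From mathcomp Require Import all_boot all_order all_algebra.
From mathcomp Require Import perm.
From mathcomp Require Import mpoly.

Set Implicit Arguments.
Unset Strict Implicit.
Unset Printing Implicit Defensive.

Import Order.TTheory GRing.Theory Num.Theory.
Local Open Scope ring_scope.

Lemma increasing_inj (k m : nat) (f : 'I_k -> 'I_m) :
  increasing f -> injective f.
Proof.
move=> hf i j eq_f; apply: val_inj => /=.
by case: (ltngtP i j) => // /hf; rewrite eq_f ltnn.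
Qed.

Lemma increasing_comp (k l m : nat) (f : 'I_l -> 'I_m) (g : 'I_k -> 'I_l) :
  increasing f -> increasing g -> increasing (f \o g).
Proof. by move=> hf hg i j /hg /hf. Qed.

Lemma increasing_lift (k : nat) (i : 'I_k.+1) : increasing (lift i).
Proof. by move=> a b ltab; rewrite /= ltnNge leq_bump2 -ltnNge. Qed.

Section Determinants.

Variables (R : idomainType) (k : nat).

Definition nz_perm (B : 'M[R]_k) (s : 'S_k) : bool :=
  [forall i, B i (s i) != 0].

Lemma det_neq0_nz_perm (B : 'M[R]_k) : \det B != 0 -> exists s, nz_perm B s.
Proof.
move=> detB; apply/existsP; apply: contraNT detB => /existsPn noB.
rewrite /determinant big1 // => s _.
have /forallPn[i] := noB s; rewrite negbK => /eqP Bi.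
by rewrite (bigD1 i) //= Bi mul0r mulr0.
Qed.

(** A nonzero cofactor has a nonzero term, coming from some [t] with [t i = j]; row [i] is absent
    from its product, but [B i j != 0] covers it. *)
Lemma cofactor_term_neq0 (B : 'M[R]_k) (i j : 'I_k) :
  B i j * cofactor B i j != 0 -> exists2 t, nz_perm B t & t i = j.
Proof.
rewrite mulf_eq0 negb_or => /andP[Bij cofB].
suff /existsP[t /andP[nzt /eqP tij]] : [exists t, nz_perm B t && (t i == j)]
  by exists t.
apply: contraNT cofB => /existsPn noB.
rewrite expand_cofactor big1 // => t /eqP tij.
have := noB t; rewrite tij eqxx andbT => /forallPn[a]; rewrite negbK => Ba.
have ai : i != a by apply: contraNneq Bij => ia; rewrite -tij ia.
by rewrite (bigD1 a) //= (eqP Ba) mul0r mulr0.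
Qed.

(** In the expansion along row [i], a nonzero summand at another column would give a perfect
    matching that moves [i] away from [s i]. *)
Lemma det_forced_entry (B : 'M[R]_k) (s : 'S_k) (i : 'I_k) :
  (forall t, nz_perm B t -> t i = s i) ->
  \det B = B i (s i) * cofactor B i (s i).
Proof.
move=> forced; rewrite (expand_det_row B i) (bigD1 (s i)) //= big1 ?addr0 //.
move=> j jsi; apply/eqP; apply: contraNT jsi => /cofactor_term_neq0[t nzt <-].
by rewrite (forced t).
Qed.

End Determinants.

Section Minor.

Variable N : nat.
Implicit Types (p : {mpoly int[N]}) (u : 'X_{1..N}).

(** [m_min] read off the determinant alone, so that signs and monomial factors can be stripped from
    the polynomial. *)
Definition min_terms p : nat :=
  minn (count (fun u => p@_u < 0) (msupp p))
       (count (fun u => 0 < p@_u) (msupp p)).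

Lemma min_termsN p : min_terms (- p) = min_terms p.
Proof.
rewrite /min_terms minnC !(seq.permP (msuppN p)).
by congr minn; apply: eq_count => u; rewrite mcoeffN ?oppr_lt0 ?oppr_gt0.
Qed.

(** Multiplying by a monomial shifts the exponents injectively and keeps every coefficient. *)
Lemma min_termsMX p u : min_terms (p * 'X_[u]) = min_terms p.
Proof.
rewrite /min_terms !(seq.permP (msuppMX p u)) !count_map.
by congr minn; apply: eq_count => v /=; rewrite mcoeffMX.
Qed.

End Minor.

(* A pair of perfect matchings [s], [t] of rows with columns, seen as a
   permutation of the vertices: follow [t] from rows and [s] from columns. *)
Definition alternate (k : nat) (s t : 'S_k) (v : vertex k k) : vertex k k :=
  match v with
  | inl i => inr (t i)
  | inr j => inl ((s^-1)%g j)
  end.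

Lemma alternate_inj (k : nat) (s t : 'S_k) : injective (alternate s t).
Proof. by move=> [i|i] [j|j] //= [] /perm_inj ->. Qed.

(** Consecutive vertices of the orbit are joined by entries of [t] (leaving rows) and of [s]
    (leaving columns). *)
Lemma alternating_cycle (N k : nat) (B : 'M[{mpoly int[N]}]_k) (s t : 'S_k)
    (i : 'I_k) :
  nz_perm B s -> nz_perm B t -> t i != s i ->
  is_cycle B (orbit (alternate s t) (inl i)).
Proof.
move=> /forallP nzs /forallP nzt tsi; rewrite /is_cycle /ucycleb orbit_uniq andbT.
apply/andP; split.
  apply: sub_cycle (cycle_orbit (@alternate_inj _ s t) _) => u v /eqP <-.
  case: u => [a|b] /=; first exact: nzt.
  by have := nzs ((s^-1)%g b); rewrite permKV.
(* Three distinct vertices of the orbit: the third is row [i] again only if [t i = s i]. *)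
pose p : seq (vertex k k) := [:: inl i; inr (t i); inl ((s^-1)%g (t i))].
apply: (@uniq_leq_size _ p).
  rewrite /= !inE /= !andbT; apply: contraNneq tsi => -[{2}->].
  by rewrite permKV.
move=> v; rewrite !inE -fconnect_orbit => /or3P[] /eqP -> //.
- exact: fconnect1.
- exact: (fconnect_iter _ 2).
Qed.

(** Column [s i] is the predecessor of row [i] under the permutation [alternate s t], so it closes
    the cycle. *)
Lemma mem_orbit_alternate (k : nat) (s t : 'S_k) (i : 'I_k) :
  inr (s i) \in orbit (alternate s t) (inl i).
Proof.
rewrite -fconnect_orbit fconnect_sym; last exact: alternate_inj.
by have := fconnect1 (alternate s t) (inr (s i)); rewrite /= permK.
Qed.

Definition vertex_map (k m n : nat) (f : 'I_k -> 'I_m) (g : 'I_k -> 'I_n)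
    (v : vertex k k) : vertex m n :=
  match v with inl i => inl (f i) | inr j => inr (g j) end.

Lemma is_cycle_mxsub (N k m n : nat) (S : 'M[{mpoly int[N]}]_(m, n))
    (f : 'I_k -> 'I_m) (g : 'I_k -> 'I_n) (p : seq (vertex k k)) :
  injective f -> injective g ->
  is_cycle (mxsub f g S) p -> is_cycle S (map (vertex_map f g) p).
Proof.
move=> injf injg /andP[/andP[cyc_p uniq_p] size_p].
rewrite /is_cycle /ucycleb size_map size_p andbT map_inj_uniq ?uniq_p ?andbT.
  rewrite cycle_map; apply: sub_cycle cyc_p => -[a|a] [b|b] //=;
  by rewrite mxE.
by move=> [a|a] [b|b] //= [] => [/injf|/injg] ->.
Qed.

(** The cycle built from [s] and [t i] passes through row [i] and column [s i]; since [s] is onto,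
    all rows and columns of the submatrix are touched. *)
Lemma balanced_of_matchings (N k m n : nat) (S : 'M[{mpoly int[N]}]_(m, n))
    (f : 'I_k -> 'I_m) (g : 'I_k -> 'I_n) (s : 'S_k) (t : 'I_k -> 'S_k) :
  injective f -> injective g -> nz_perm (mxsub f g S) s ->
  (forall i, nz_perm (mxsub f g S) (t i)) -> (forall i, t i i != s i) ->
  balanced_submatrix S f g.
Proof.
move=> injf injg nzs nzt tsi.
pose c i := map (vertex_map f g) (orbit (alternate s (t i)) (inl i)).
pose cs := [seq c i | i <- enum 'I_k].
have rowsE : rows_touched cs = [set f i | i : 'I_k].
  apply/setP=> r; rewrite inE has_map; apply/hasP/imsetP.
    by case=> i _ /mapP[[a|a] _ //= [->]]; exists a.
  case=> i _ ->; exists i; first by rewrite mem_enum.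
  by apply/mapP; exists (inl i) => //; apply: in_orbit.
have colsE : cols_touched cs = [set g i | i : 'I_k].
  apply/setP=> r; rewrite inE has_map; apply/hasP/imsetP.
    by case=> i _ /mapP[[a|a] _ //= [->]]; exists a.
  case=> j _ ->; exists ((s^-1)%g j); first by rewrite mem_enum.
  apply/mapP; exists (inr j) => //.
  by rewrite -{1}(permKV s j) mem_orbit_alternate.
exists cs; split=> //; split; last by rewrite rowsE colsE !card_imset.
apply/allP=> _ /mapP[i _ ->]; apply: is_cycle_mxsub => //.
exact: alternating_cycle.
Qed.

(** The entry [B i j] is a variable up to sign, and neither a sign nor a monomial factor changes
    [min_terms]. *)
Lemma m_min_forced_entry (m n k : nat) (S : 'M[{mpoly int[m * n]}]_(m, n))
    (f : 'I_k.+1 -> 'I_m) (g : 'I_k.+1 -> 'I_n) (i j : 'I_k.+1)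
    (B := mxsub f g S) :
  sign_pattern S -> \det B != 0 -> \det B = B i j * cofactor B i j ->
  let A := mxsub (lift i) (lift j) B in \det A != 0 /\ m_min A = m_min B.
Proof.
move=> hS detB detE A.
have AE : row' i (col' j B) = A by apply/matrixP=> a b; rewrite !mxE.
rewrite /cofactor AE in detE.
split; first by apply: contraNneq detB => A0; rewrite detE A0 !mulr0.
change (min_terms (\det A) = min_terms (\det B)).
have {}detE : \det B = (-1) ^+ (i + j) * (B i j * \det A).
  by rewrite detE mulrCA.
have -> : min_terms (\det B) = min_terms (B i j * \det A).
  by rewrite detE -signr_odd; case: odd; rewrite ?mul1r // mulN1r min_termsN.
have Bij : B i j != 0.
  by apply: contraNneq detB => B0; rewrite detE B0 mul0r mulr0.
move: Bij; rewrite /B mxE.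
case: (hS (f i) (g j)) => ->; rewrite ?eqxx // => _.
- by rewrite mulrC min_termsMX.
- by rewrite mulNr min_termsN mulrC min_termsMX.
Qed.

Theorem proposition2p16 (m n : nat) (S : 'M[{mpoly int[m * n]}]_(m, n))
    (hS : sign_pattern S)
    (k : nat) (f : 'I_k -> 'I_m) (g : 'I_k -> 'I_n)
    (hf : increasing f) (hg : increasing g)
    (hB : invertible_pattern (mxsub f g S)) :
  exists (l : nat) (f' g' : 'I_l -> 'I_k),
    [/\ increasing f', increasing g',
        balanced_submatrix S (f \o f') (g \o g')
      & m_min (mxsub f' g' (mxsub f g S)) = m_min (mxsub f g S)].
Proof.
elim: k => [|k IHk] in f g hf hg hB *; have [s nzs] := det_neq0_nz_perm hB.
  (* In size 0 there is no row to move, and the empty set of cycles suffices. *)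
  exists 0, id, id; split=> //; last by rewrite mxsub_id.
  by apply: (@balanced_of_matchings _ _ _ _ _ _ _ s (fun=> s)) => // -[].
set B := mxsub f g S in hB nzs *.
pose moves i t := nz_perm B t && (t i != s i).
have [/forallP moved | /forallPn[i /existsPn fixed]] :=
  boolP [forall i, exists t, moves i t].
  have /fin_all_exists[t tP] : forall i, exists t, moves i t.
    by move=> i; apply/existsP.
  exists k.+1, id, id; split=> //; last by rewrite mxsub_id.
  apply: (@balanced_of_matchings _ _ _ _ _ _ _ s t) => //.
  - exact: increasing_inj.
  - exact: increasing_inj.
  - by move=> i; case/andP: (tP i).
  - by move=> i; case/andP: (tP i).
have detE : \det B = B i (s i) * cofactor B i (s i).
  apply: det_forced_entry => t nzt; apply/eqP.
  by have := fixed t; rewrite /moves nzt negbK.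
have [detA mA] := m_min_forced_entry hS hB detE.
(* Nested submatrices of [B] are rewritten as submatrices of [S], to which the induction hypothesis
   applies. *)
have subE (l : nat) (f' g' : 'I_l -> 'I_k) :
    mxsub (lift i \o f') (lift (s i) \o g') B =
    mxsub f' g' (mxsub (f \o lift i) (g \o lift (s i)) S).
  by apply/matrixP=> a b; rewrite !mxE.
have AE : mxsub (lift i) (lift (s i)) B =
    mxsub (f \o lift i) (g \o lift (s i)) S.
  by apply/matrixP=> a b; rewrite !mxE.
have hf1 := increasing_comp hf (@increasing_lift _ i).
have hg1 := increasing_comp hg (@increasing_lift _ (s i)).
have [|l [f' [g' [hf' hg' balA mA']]]] := IHk _ _ hf1 hg1.
  by rewrite /invertible_pattern -AE.
exists l, (lift i \o f'), (lift (s i) \o g'); split=> //.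
- exact: increasing_comp (@increasing_lift _ i) hf'.
- exact: increasing_comp (@increasing_lift _ (s i)) hg'.
- by rewrite subE mA' -AE.
Qed.
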